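(* The set $QI(\mathbb{R}_+)/\overline{H_c}$ of right cosets $\overline{H_c}[g]$ of the subgroup $\overline{H_c}$ in $QI(\mathbb{R}_+)$ decomposes as $$QI(\mathbb{R}_+)/\overline{H_c}=\bigsqcup_{M\ge 1}H_{[1,M]}/H,$$ in the sense that the map $H[g]\mapsto\overline{H_c}[g]$ is a bijection from the disjoint union $\bigsqcup_{M\ge1}H_{[1,M]}/H$ onto the set of right cosets of $\overline{H_c}$ in $QI(\mathbb{R}_+)$.
   Context: $\mathbb{R}_+=[0,\infty)$. $QI(\mathbb{R}_+)$ is the group (under composition) of quasi-isometries $\mathbb{R}_+\to\mathbb{R}_+$ modulo the relation of being at bounded distance; $[g]$ denotes the class of $g$. For $[g]\in QI(\mathbb{R}_+)$ set $$S_{[g]}=\Big\{\lim_{n\to\infty}\tfrac{g(x_n)}{x_n} : x_n\to\infty \text{ and } \tfrac{g(x_n)}{x_n}\text{ converges}\Big\}.$$ For $c>0$, $H_c=\{[g]: S_{[g]}=\{c\}\}$, and $\overline{H_c}=\bigcup_{c\in\mathbb{R}_{>0}}H_c$, which is a subgroup of $QI(\mathbb{R}_+)$. For $M\ge1$, $H_{[1,M]}=\{[g]:S_{[g]}=[1,M]\}$ (where $[1,1]=\{1\}$). $H=H_1=\{[g]:\lim_{x\to\infty}g(x)/x=1\}$, a normal subgroup of $QI(\mathbb{R}_+)$, which acts on $H_{[1,M]}$ by left multiplication; $H_{[1,M]}/H$ is the set of orbits $H[g]$. *)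

(* Defs.v *)
From HB Require Import structures.
From mathcomp Require Import all_boot all_order all_algebra.
From mathcomp Require Import all_classical all_reals all_analysis.
From mathcomp Require Import lra.
Set Implicit Arguments.
Unset Strict Implicit.
Unset Printing Implicit Defensive.
Import Order.TTheory GRing.Theory Num.Theory.
Import numFieldTopology.Exports numFieldNormedType.Exports.
Local Open Scope quotient_scope.
Local Open Scope classical_set_scope.
Local Open Scope ring_scope.

Section QuasiIsometry.
Variable R : realType.

(* The half-line [0, +oo[ is {nonneg R}; x%:num is the underlying real. *)
Implicit Types f g h : {nonneg R} -> {nonneg R}.

Definition quasi_isometry f : Prop := exists K C : R,
  [/\ 1 <= K, 0 <= C,
      forall x y : {nonneg R},
        K^-1 * `|x%:num - y%:num| - C <= `|(f x)%:num - (f y)%:num|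
          <= K * `|x%:num - y%:num| + C &
      forall y : {nonneg R}, exists x : {nonneg R},
        `|(f x)%:num - y%:num| <= C].

Definition bounded_distance f g : Prop :=
  exists D : R, forall x : {nonneg R}, `|(f x)%:num - (g x)%:num| <= D.

Lemma bounded_distance_refl f : bounded_distance f f.
Proof. by exists 0 => x; rewrite subrr normr0. Qed.

Lemma bounded_distance_sym f g : bounded_distance f g -> bounded_distance g f.
Proof. by case=> D HD; exists D => x; rewrite distrC. Qed.

Lemma bounded_distance_trans f g h :
  bounded_distance f g -> bounded_distance g h -> bounded_distance f h.
Proof.
move=> [D HD] [E HE]; exists (D + E) => x.
by rewrite (le_trans (ler_distD (g x)%:num _ _))// lerD.
Qed.

Lemma quasi_isometry_le f : quasi_isometry f -> exists K C : R,
  [/\ 1 <= K, 0 <= C,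
      forall x y : {nonneg R},
        `|x%:num - y%:num| <= K * (`|(f x)%:num - (f y)%:num| + C),
      forall x y : {nonneg R},
        `|(f x)%:num - (f y)%:num| <= K * `|x%:num - y%:num| + C &
      forall y : {nonneg R}, exists x : {nonneg R},
        `|(f x)%:num - y%:num| <= C].
Proof.
move=> [K [C [K1 C0 H S]]]; exists K, C; split=> // x y.
  have K0 : 0 < K by lra.
  have /andP[+ _] := H x y.
  by rewrite lerBlDr mulrC ler_pdivrMr// mulrC.
by have /andP[] := H x y.
Qed.

Lemma quasi_isometryP f (K C : R) : 1 <= K -> 0 <= C ->
  (forall x y : {nonneg R},
     `|x%:num - y%:num| <= K * (`|(f x)%:num - (f y)%:num| + C)) ->
  (forall x y : {nonneg R},
     `|(f x)%:num - (f y)%:num| <= K * `|x%:num - y%:num| + C) ->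
  (forall y : {nonneg R}, exists x : {nonneg R},
     `|(f x)%:num - y%:num| <= C) ->
  quasi_isometry f.
Proof.
move=> K1 C0 H1 H2 S; exists K, C; split=> // x y.
have K0 : 0 < K by lra.
by rewrite H2 andbT lerBlDr mulrC ler_pdivrMr// mulrC.
Qed.

Lemma quasi_isometry_id : quasi_isometry id.
Proof.
apply: (@quasi_isometryP _ 1 0) => // [x y|x y|y].
- by rewrite mul1r addr0.
- by rewrite mul1r addr0.
- by exists y; rewrite subrr normr0.
Qed.

Lemma quasi_isometry_comp f g :
  quasi_isometry f -> quasi_isometry g -> quasi_isometry (f \o g).
Proof.
move=> /quasi_isometry_le[K [C [K1 C0 L1 U1 S1]]].
move=> /quasi_isometry_le[J [B [J1 B0 L2 U2 S2]]].
have KC : 0 <= K * C by rewrite mulr_ge0//; lra.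
have KB : 0 <= K * B by rewrite mulr_ge0//; lra.
have K0 : 0 <= K by lra.
have J0 : 0 <= J by lra.
apply: (@quasi_isometryP _ (K * J) (K * B + B + 2 * C)).
- by rewrite (le_trans K1)// ler_peMr.
- by lra.
- move=> x y /=; apply: (le_trans (L2 x y)).
  rewrite -mulrA mulrCA ler_wpM2l//.
  have := L1 (g x) (g y).
  have : B <= K * B by rewrite ler_peMl.
  have : 0 <= K * (K * B) by rewrite mulr_ge0.
  by rewrite !mulrDr; lra.
- move=> x y /=; apply: (le_trans (U1 _ _)).
  have : K * `|(g x)%:num - (g y)%:num| <= K * (J * `|x%:num - y%:num| + B).
    by rewrite ler_wpM2l.
  by rewrite mulrDr mulrA; lra.
- move=> y; have [z Hz] := S1 y; have [x Hx] := S2 z; exists x => /=.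
  have := ler_distD (f z)%:num (f (g x))%:num y%:num.
  have := U1 (g x) z.
  have : K * `|(g x)%:num - z%:num| <= K * B by rewrite ler_wpM2l.
  by lra.
Qed.

Lemma quasi_isometry_inv f : quasi_isometry f -> exists g,
  [/\ quasi_isometry g, bounded_distance (g \o f) id &
      bounded_distance (f \o g) id].
Proof.
move=> /quasi_isometry_le[K [C [K1 C0 L U S]]].
have /choice[g Hg] := S.
have K0 : 0 <= K by lra.
have CK : C <= K * C by rewrite ler_peMl.
exists g; split; last by exists C => x /=; exact: Hg.
- apply: (@quasi_isometryP _ K (3 * (K * C))) => //; first lra.
  + move=> y z.
    have := ler_distD (f (g y))%:num y%:num z%:num.
    have := ler_distD (f (g z))%:num (f (g y))%:num z%:num.
    have := Hg y; have := Hg z; rewrite (distrC y%:num (f (g y))%:num).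
    have := U (g y) (g z).
    have : K * C <= K * (K * C) by rewrite ler_peMl// mulr_ge0.
    by rewrite mulrDr (mulrCA K 3); lra.
  + move=> y z; apply: (le_trans (L _ _)).
    have : `|(f (g y))%:num - (f (g z))%:num| + C
        <= `|y%:num - z%:num| + 3 * C.
      have := ler_distD y%:num (f (g y))%:num (f (g z))%:num.
      have := ler_distD z%:num y%:num (f (g z))%:num.
      by have := Hg y; have := Hg z; rewrite (distrC z%:num (f (g z))%:num); lra.
    move=> /(ler_wpM2l K0)/le_trans; apply.
    by rewrite mulrDr (mulrCA K 3).
  + move=> x; exists (f x).
    apply: (le_trans (L _ _)).
    have := ler_wpM2l K0 (Hg (f x)).
    have : 0 <= K * C by rewrite mulr_ge0.
    by rewrite mulrDr; lra.
- exists (K * (C + C)) => x /=.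
  by apply: (le_trans (L _ _)); rewrite ler_wpM2l// lerD2r.
Qed.

Lemma bounded_distance_comp f f' g g' : quasi_isometry f ->
  bounded_distance f f' -> bounded_distance g g' ->
  bounded_distance (f \o g) (f' \o g').
Proof.
move=> /quasi_isometry_le[K [C [K1 C0 _ U _]]] [D HD] [E HE].
have K0 : 0 <= K by lra.
exists (K * E + C + D) => x /=.
have := ler_distD (f (g' x))%:num (f (g x))%:num (f' (g' x))%:num.
have := ler_wpM2l K0 (HE x).
by have := U (g x) (g' x); have := HD (g' x); lra.
Qed.

Definition qiso := {f : {nonneg R} -> {nonneg R} | `[< quasi_isometry f >]}.

Definition qiso_mk f (hf : quasi_isometry f) : qiso := exist _ f (asboolT hf).

Lemma qisoP (f : qiso) : quasi_isometry (val f).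
Proof. exact/asboolP/(valP f). Qed.

Definition qiso1 : qiso := qiso_mk quasi_isometry_id.

Definition qisoM (f g : qiso) : qiso :=
  qiso_mk (quasi_isometry_comp (qisoP f) (qisoP g)).

Definition qisoV (f : qiso) : qiso :=
  let: exist _ H := cid (quasi_isometry_inv (qisoP f)) in
  qiso_mk (let: And3 hg _ _ := H in hg).

Lemma qisoVP (f : qiso) :
  bounded_distance (val (qisoV f) \o val f) id /\
  bounded_distance (val f \o val (qisoV f)) id.
Proof. by rewrite /qisoV; case: cid => g [? ? ?]. Qed.

Definition close : rel qiso := fun a b : qiso =>
  `[< bounded_distance (val a) (val b) >].

Lemma close_equiv : equiv_class_of close.
Proof.
split=> [f|f g|g f h].
- exact/asboolP/bounded_distance_refl.
- by apply/asboolP/asboolP; exact: bounded_distance_sym.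
- by move=> /asboolP fg /asboolP gh; apply/asboolP/(bounded_distance_trans fg gh).
Qed.

Canonical close_equivRel := EquivRelPack close_equiv.

Definition QI := {eq_quot close}.

HB.instance Definition _ := Choice.on QI.
HB.instance Definition _ := EqQuotient.on QI.

Lemma QIP (f g : qiso) :
  \pi_QI f = \pi_QI g <-> bounded_distance (val f) (val g).
Proof.
by split=> [/eqmodP/asboolP//|H]; apply/eqmodP/asboolP.
Qed.

Lemma QI_repr (f : qiso) : bounded_distance (val (repr (\pi_QI f))) (val f).
Proof. by apply/QIP; rewrite reprK. Qed.

Definition QI1 : QI := \pi_QI qiso1.
Definition QIM (a b : QI) : QI := \pi_QI (qisoM (repr a) (repr b)).
Definition QIV (a : QI) : QI := \pi_QI (qisoV (repr a)).

Lemma QIM_pi (f g : qiso) : QIM (\pi_QI f) (\pi_QI g) = \pi_QI (qisoM f g).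
Proof.
by apply/QIP; apply: bounded_distance_comp; [exact: qisoP|exact: QI_repr..].
Qed.

Lemma QI_ind (P : QI -> Prop) : (forall f : qiso, P (\pi_QI f)) -> forall a, P a.
Proof. by move=> H a; rewrite -(reprK a). Qed.

Lemma QIMA : associative QIM.
Proof.
elim/QI_ind=> f; elim/QI_ind=> g; elim/QI_ind=> h.
by rewrite !QIM_pi; apply/QIP; exact: bounded_distance_refl.
Qed.

Lemma QI1M : left_id QI1 QIM.
Proof.
by elim/QI_ind=> f; rewrite QIM_pi; apply/QIP; exact: bounded_distance_refl.
Qed.

Lemma QIM1 : right_id QI1 QIM.
Proof.
by elim/QI_ind=> f; rewrite QIM_pi; apply/QIP; exact: bounded_distance_refl.
Qed.

Lemma QIVM : left_inverse QI1 QIV QIM.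
Proof.
by move=> a; rewrite -{2}(reprK a) QIM_pi; apply/QIP; have [] := qisoVP (repr a).
Qed.

Lemma QIMV : right_inverse QI1 QIV QIM.
Proof.
by move=> a; rewrite -{1}(reprK a) QIM_pi; apply/QIP; have [] := qisoVP (repr a).
Qed.

(* The product is induced by composition: [f] * [g] = [f \o g]. *)
HB.instance Definition _ := isGroup.Build QI QIMA QI1M QIM1 QIVM QIMV.

Lemma QI_mul_pi (f g : qiso) :
  (\pi_QI f * \pi_QI g)%g = \pi_QI (qisoM f g).
Proof. exact: QIM_pi. Qed.

Definition slope_limits f : set R := [set l | exists x : nat -> {nonneg R},
  ((fun n => (x n)%:num) @ \oo --> +oo) /\
  ((fun n => (f (x n))%:num / (x n)%:num) @ \oo --> l)].

(* Independent of the representative by slope_set_pi below. *)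
Definition slope_set (a : QI) : set R := slope_limits (val (repr a)).

Lemma slope_limits_close f g :
  bounded_distance f g -> slope_limits f `<=` slope_limits g.
Proof.
move=> [D HD] l [x [xoo fl]]; exists x; split => //.
have dV : (fun n => ((g (x n))%:num - (f (x n))%:num) / (x n)%:num) @ \oo
    --> (0 : R).
  apply/cvgr0Pnorm_le => e e0.
  have D0 : 0 <= D by apply: le_trans (HD 0%:nng).
  move/cvgryPgt : xoo => /(_ (D / e)); apply: filterS => n.
  rewrite ltr_pdivrMr// => xD.
  have x0 : 0 < (x n)%:num by rewrite -(pmulr_lgt0 _ e0) (le_lt_trans D0).
  rewrite normrM normfV (gtr0_norm x0) ler_pdivrMr// distrC.
  apply: (le_trans (HD _)); by rewrite mulrC ltW.
rewrite (_ : (fun n => _) = (fun n => (f (x n))%:num / (x n)%:num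
    + ((g (x n))%:num - (f (x n))%:num) / (x n)%:num)); last first.
  by apply/funext => n; rewrite -mulrDl addrC subrK.
by rewrite -[l]addr0; exact: cvgD.
Qed.

Lemma slope_set_pi (f : qiso) : slope_set (\pi_QI f) = slope_limits (val f).
Proof.
have H := QI_repr f.
apply/seteqP; split; apply: slope_limits_close => //.
exact: bounded_distance_sym.
Qed.

End QuasiIsometry.

Section Cosets.
Variable R : realType.

Definition Hc (c : R) : set (QI R) := [set g | slope_set g = [set c]].

Definition Hc_bar : set (QI R) := \bigcup_(c in [set c : R | 0 < c]) Hc c.

Definition Hitv (M : R) : set (QI R) :=
  [set g | slope_set g = [set` `[1, M]]].

(* For a subgroup A, the right coset of g, which is also the orbit of g under
   left multiplication by A. *)
Definition right_coset (A : set (QI R)) (g : QI R) : set (QI R) :=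
  [set (h * g)%g | h in A].

Definition right_cosets (A : set (QI R)) : set (set (QI R)) :=
  range (right_coset A).

Definition Hitv_orbits (M : R) : set (set (QI R)) :=
  right_coset (Hc 1) @` Hitv M.

(* The disjoint union over M >= 1 of the orbit sets, each tagged by its M. *)
Definition Hitv_orbits_sum : set (R * set (QI R)) :=
  [set p | 1 <= p.1 /\ Hitv_orbits p.1 p.2].

End Cosets.

Arguments Hc_bar R : clear implicits.
Arguments Hitv_orbits_sum R : clear implicits.

(* Main.v *)
Require Import Defs.
From mathcomp Require Import all_boot all_order all_algebra.
From mathcomp Require Import all_classical all_reals all_analysis.
From mathcomp Require Import ring lra.
Import Order.TTheory GRing.Theory Num.Theory.
Local Open Scope classical_set_scope.
Local Open Scope ring_scope.

(** For a quasi-isometry f of the half-line the slope f x / x is bounded and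
bounded away from 0 for large x, and it varies slowly: it changes by o(1) when
x moves by at most 1. So although f need not be continuous, the slope cannot
jump over a value l infinitely often without accumulating at l, and its set of
limit values is the whole compact interval from its lower to its upper limit,
with positive left end (slope_limits_itv). In particular the set of limit
values is a single point c exactly when the slope converges to c.

Write (h g)(x) / x = (h (g x) / g x) * (g x / x). When the slope of h converges
to c > 0, the limit values for h g are therefore c times those of g
(slope_limits_comp, slope_setM). This one identity gives the group laws of the
classes with a single slope: products multiply slopes, inverses invert them.

Let S_g be the interval [a, b]. Multiplying g on the left by the dilation of
ratio 1 / a turns it into [1, b / a], so each right coset of the large subgroup
meets the classes with interval [1, M] for M = b / a. If g and h g have the
intervals [1, M] and [1, M'], where h has slope c, then [c, c M] = [1, M'], so
c = 1 and M = M': both M and the orbit under the slope-1 subgroup are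
determined by the coset. *)

(** * Compact intervals *)

Section Intervals.
Context {R : realType}.
Implicit Types a b c : R.

Lemma itv_bounds_inj a b a' b' : a <= b -> a' <= b' ->
  [set` `[a, b]] = [set` `[a', b']] -> a = a' /\ b = b'.
Proof.
move=> ab ab' E.
have mem x y z : ([set` `[y, z]] x : Prop) = (y <= x <= z) by rewrite /= in_itv.
have /andP[a'a _] : a' <= a <= b' by rewrite -mem -E mem lexx.
have /andP[_ bb'] : a' <= b <= b' by rewrite -mem -E mem lexx andbT.
have /andP[aa' _] : a <= a' <= b by rewrite -mem E mem lexx.
have /andP[_ b'b] : a <= b' <= b by rewrite -mem E mem lexx andbT.
by split; apply/eqP; rewrite eq_le; apply/andP.
Qed.

Lemma image_mul_itv c a b : 0 < c ->
  [set c * l | l in [set` `[a, b]]] = [set` `[c * a, c * b]].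
Proof.
move=> c0; apply/seteqP; split=> [_ [l + <-]|l] /=; rewrite !in_itv /=.
  by rewrite !ler_pM2l.
move=> /andP[al lb]; exists (l / c); last by rewrite mulrC divfK// gt_eqF.
by rewrite /= in_itv /= ler_pdivlMr// ler_pdivrMr// mulrC al mulrC lb.
Qed.

End Intervals.

(** * Asymptotic slopes of quasi-isometries *)

Section Slopes.
Context {R : realType}.
Implicit Types (f g h : {nonneg R} -> {nonneg R}) (P Q : {nonneg R} -> Prop).

Definition slope f (x : {nonneg R}) : R := (f x)%:num / x%:num.

(** The threshold is positive so that the quotients by x are not affected by the
convention for division by 0. *)
Definition for_large P : Prop :=
  exists2 N : R, 0 < N & forall x, N <= x%:num -> P x.

Lemma for_largeW P Q :
  (forall x, 0 < x%:num -> P x -> Q x) -> for_large P -> for_large Q.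
Proof.
move=> PQ [N N0 H]; exists N => // x Nx.
by apply: PQ; [exact: lt_le_trans Nx|exact: H].
Qed.

Lemma for_largeI P Q :
  for_large P -> for_large Q -> for_large (fun x => P x /\ Q x).
Proof.
move=> [N N0 HP] [M M0 HQ]; exists (Num.max N M); first by rewrite lt_max N0.
by move=> x; rewrite ge_max => /andP[? ?]; split; [exact: HP|exact: HQ].
Qed.

Lemma for_large_ge (N : R) : for_large (fun x => N <= x%:num).
Proof.
exists (Num.max N 1); first by rewrite lt_max ltr01 orbT.
by move=> x; rewrite ge_max => /andP[].
Qed.

Lemma for_large_witness P : for_large P -> exists x, 0 < x%:num /\ P x.
Proof. by move=> [N N0 H]; exists (NngNum (ltW N0)); split=> //; apply: H. Qed.

(** Limits along sequences become a statement about arbitrarily large points,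
which spares the later lemmas from handling sequences: a point at distance at
most 1 / (n + 1) from l, chosen beyond n, gives the sequence back. *)
Lemma slope_limitsP f (l : R) : slope_limits f l <->
  forall e : R, 0 < e -> forall P, for_large P ->
    exists x, [/\ 0 < x%:num, P x & `|slope f x - l| <= e].
Proof.
split=> [[x [xoo fl]] e e0 P /(for_largeI _ _ (for_large_ge 1))[N _ HN]|H].
- move/cvgryPge : xoo => /(_ N) xoo.
  move/cvgrPdist_le : fl => /(_ e e0) fl.
  have [n [Nx xl]] := filter_ex (filterI xoo fl).
  have [x1 Px] := HN _ Nx.
  by exists (x n); rewrite distrC; split=> //; exact: lt_le_trans x1.
- have /choice[x Hx] : forall n : nat, exists x : {nonneg R},
      n%:R <= x%:num /\ `|slope f x - l| <= n.+1%:R^-1.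
    move=> n.
    have n0 : 0 < (n.+1%:R : R)^-1 by rewrite invr_gt0 ltr0n.
    by have [y [? ? ?]] := H _ n0 _ (for_large_ge n%:R); exists y.
  exists x; split.
    apply/cvgryPge => A; near=> n.
    apply: le_trans (Hx n).1; near: n; exact: nbhs_infty_ger.
  apply/cvgrPdist_le => e e0; near=> n.
  rewrite distrC; apply: le_trans (Hx n).2 _; apply: ltW.
  by near: n; exact: (near_infty_natSinv_lt (PosNum e0)).
Unshelve. all: by end_near. Qed.

(** Compare f x with the value of f at the origin: the additive constant c is
at most half of the main term x / K as soon as x is at least 2 K c. *)
Lemma quasi_isometry_slope_bounds f : quasi_isometry f ->
  exists a b : R, 0 < a /\ for_large (fun x => a <= slope f x <= b).
Proof.
move=> [K [C [K1 C0 H _]]]; pose o := NngNum (lexx (0 : R)).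
pose c := C + (f o)%:num.
have c0 : 0 <= c by rewrite addr_ge0.
have K0 : 0 < K by lra.
exists (2 * K)^-1, (K + c); split; first by rewrite invr_gt0; lra.
have := for_largeI _ _ (for_large_ge 1) (for_large_ge (2 * K * c)).
apply: for_largeW => x x0 [x1 xc].
have := H x o; rewrite /= subr0 (ger0_norm (ltW x0)).
rewrite /slope ler_pdivlMr// ler_pdivrMr//.
have h1 : (2 * K)^-1 * x%:num = K^-1 * x%:num / 2 by field; lra.
have h2 : 2 * c <= K^-1 * x%:num.
  by rewrite ler_pdivlMl// mulrCA mulrA.
have h3 : c <= c * x%:num by rewrite ler_peMr.
rewrite h1 mulrDl => /andP[Hl Hu].
have := ler_norm ((f x)%:num - (f o)%:num).
have fx : 0 <= (f x)%:num by [].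
have f0 : 0 <= (f o)%:num by [].
have := ler_normB (f x)%:num (f o)%:num.
rewrite (ger0_norm fx) (ger0_norm f0); have cE : c = C + (f o)%:num by [].
move=> ? ?; apply/andP; split; lra.
Qed.

(** The substitute for continuity of the slope. Between x and y with
x <= y <= x + 1 the numerator f moves by at most K + C and the slope itself is
bounded by b, so the slope moves by at most (K + C + b) / y. *)
Lemma quasi_isometry_slope_step f (e : R) : quasi_isometry f -> 0 < e ->
  for_large (fun x => forall y, x%:num <= y%:num <= x%:num + 1 ->
    `|slope f y - slope f x| <= e).
Proof.
move=> qf e0; have [a [b [a0 Hab]]] := quasi_isometry_slope_bounds f qf.
have [K [C [K1 C0 H _]]] := qf.
have := for_largeI _ _ Hab (for_large_ge ((K + C + b) / e)).
apply: for_largeW => x x0 [/andP[ax xb] Nx] y /andP[xy yx].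
have y0 : 0 < y%:num by exact: lt_le_trans xy.
have -> : slope f y - slope f x
    = (((f y)%:num - (f x)%:num) - slope f x * (y%:num - x%:num)) / y%:num.
  by rewrite /slope; field; rewrite !gt_eqF.
rewrite normrM normfV (gtr0_norm y0) ler_pdivrMr//.
apply: (le_trans (ler_normB _ _)).
have yx0 : 0 <= y%:num - x%:num by lra.
have s0 : 0 <= slope f x by lra.
rewrite (normrM (slope f x)) (ger0_norm yx0) (ger0_norm s0).
have /andP[_] := H y x; rewrite (ger0_norm yx0) => Hu.
have : K * (y%:num - x%:num) <= K by rewrite ler_piMr; lra.
have : slope f x * (y%:num - x%:num) <= slope f x by rewrite ler_piMr; lra.
have : e * x%:num <= e * y%:num by rewrite ler_pM2l.
move: Nx; rewrite ler_pdivrMr// mulrC; lra.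
Qed.

(** Induction along the half-line in steps of length at most 1. *)
Lemma for_large_step P (x0 : {nonneg R}) :
  (forall x y, x0%:num <= x%:num -> P x ->
     x%:num <= y%:num <= x%:num + 1 -> P y) ->
  P x0 -> forall x, x0%:num <= x%:num -> P x.
Proof.
move=> step P0 x x0x.
have [n] : exists n : nat, x%:num <= x0%:num + n%:R.
  have xge0 : 0 <= x%:num by [].
  exists (Num.truncn (x%:num)).+1; have : 0 <= x0%:num by [].
  have /andP[_] := truncn_itv xge0; lra.
elim: n x x0x => [|n IH] x x0x xn.
  apply: (step x0) => //; apply/andP; split; lra.
have [xx|xx] := leP x%:num (x0%:num + 1).
  by apply: (step x0) => //; rewrite x0x.
have x10 : 0 <= x%:num - 1 by have : 0 <= x0%:num by []; lra.
apply: (step (NngNum x10)) => /=; first lra.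
  by apply: IH => /=; move: xn; rewrite -natr1; lra.
by apply/andP; split; lra.
Qed.

(** A discrete intermediate value theorem: beyond the point where each unit step
changes the slope by at most e, the slope cannot cross a forbidden band of
width 2 e, so it stays on the side where it is at that point. *)
Lemma slope_gap f (l e : R) : quasi_isometry f -> 0 < e ->
  for_large (fun x => e < `|slope f x - l|) ->
  for_large (fun x => slope f x <= l - e) \/ for_large (fun x => l + e <= slope f x).
Proof.
move=> qf e0 gap.
have := for_largeI _ _ gap (quasi_isometry_slope_step _ _ qf e0).
move=> [N N0 HN].
pose x0 := NngNum (ltW N0).
have side x : x0%:num <= x%:num -> slope f x <= l - e \/ l + e <= slope f x.
  by move=> /HN[]; rewrite lter_normr => /orP[]; [right|left]; lra.
have [sx|sx] := side x0 (lexx _); [left|right]; exists N => // x Nx.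
- apply: (for_large_step (fun x => slope f x <= l - e) x0) => // {x Nx}.
  move=> x y Nx sxl xy; have [_ /(_ y xy)] := HN _ Nx.
  rewrite ler_norml => /andP[_ ?].
  have /andP[xy1 _] := xy.
  by case: (side y) => [||?] //; [exact: le_trans xy1|lra].
- apply: (for_large_step (fun x => l + e <= slope f x) x0) => // {x Nx}.
  move=> x y Nx sxl xy; have [_ /(_ y xy)] := HN _ Nx.
  rewrite ler_norml => /andP[? _].
  have /andP[xy1 _] := xy.
  by case: (side y) => [|?|] //; [exact: le_trans xy1|lra].
Qed.

(** The ends are the lower and upper limits of the slope, obtained as the
supremum of the eventual lower bounds and the infimum of the eventual upper
bounds. A value between them that is not a limit would, by the gap lemma, lie
strictly above an eventual upper bound or strictly below an eventual lower
bound. *)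
Lemma slope_limits_itv f : quasi_isometry f -> exists a b : R,
  [/\ 0 < a, a <= b, slope_limits f = [set` `[a, b]] &
      forall e, 0 < e -> for_large (fun x => a - e <= slope f x <= b + e)].
Proof.
move=> qf; have [k [K [k0 HkK]]] := quasi_isometry_slope_bounds f qf.
pose A := [set t : R | for_large (fun x => t <= slope f x)].
pose B := [set t : R | for_large (fun x => slope f x <= t)].
have Ak : A k by apply: for_largeW HkK => x _ /andP[].
have BK : B K by apply: for_largeW HkK => x _ /andP[].
have AB s t : A s -> B t -> s <= t.
  move=> As Bt; have [x [_ [? ?]]] := for_large_witness _ (for_largeI _ _ As Bt).
  lra.
have supA : has_sup A by split; [exists k|exists K => s As; exact: AB].
have infB : has_inf B by split; [exists K|exists k => s Bs; exact: AB].
have ev e : 0 < e -> for_large (fun x => sup A - e <= slope f x <= inf B + e).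
  move=> e0; have [s As es] := sup_adherent e0 supA.
  have [t Bt te] := inf_adherent e0 infB.
  apply: for_largeW (for_largeI _ _ As Bt) => x _ [? ?].
  apply/andP; split; lra.
exists (sup A), (inf B); split=> //.
- exact: lt_le_trans (sup_upper_bound supA Ak).
- apply: ge_sup; first by exists k.
  by move=> s As; apply: lb_le_inf; [exists K|move=> t Bt; exact: AB].
- apply/seteqP; split=> l /=; rewrite in_itv/=.
  + move=> /slope_limitsP H; apply/andP; split; apply/ler_addgt0Pl => e e0.
    * have e20 : 0 < e / 2 by lra.
      have [x [_ /andP[? _]]] := H _ e20 _ (ev _ e20).
      by rewrite ler_norml => /andP[? ?]; lra.
    * have e20 : 0 < e / 2 by lra.
      have [x [_ /andP[_ ?]]] := H _ e20 _ (ev _ e20).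
      by rewrite ler_norml => /andP[? ?]; lra.
  + move=> /andP[al lb]; apply/slope_limitsP => e e0 P HP.
    apply: contrapT => none.
    have gap : for_large (fun x => e < `|slope f x - l|).
      apply: for_largeW HP => x x0 Px; rewrite ltNge; apply/negP => le.
      by apply: none; exists x.
    have [Bl|Al] := slope_gap _ _ _ qf e0 gap.
    * by have := ge_inf infB.2 Bl; lra.
    * by have := sup_upper_bound supA Al; lra.
Qed.

(** A single limit value makes the lower and upper limits coincide, so the
slope converges; compactness enters through the interval description. *)
Lemma slope_limits1 f (c : R) : quasi_isometry f -> slope_limits f = [set c] ->
  forall e, 0 < e -> for_large (fun x => `|slope f x - c| <= e).
Proof.
move=> /slope_limits_itv[a [b [a0 ab -> ev]]] abc e e0.
have [ac bc] : a = c /\ b = c.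
  by apply: itv_bounds_inj => //; rewrite abc set_itv1.
apply: for_largeW (ev e e0) => x _; rewrite ac bc ler_distl; lra.
Qed.

(** The slopes of f o g and c times those of g differ by
(f (g x) / g x - c) * (g x / x), where the first factor tends to 0 because g x
tends to infinity with x, and the second is bounded. Asymptotic functions have the
same limit values. *)
Lemma slope_limits_comp f g (c : R) : quasi_isometry f -> quasi_isometry g ->
  0 < c -> slope_limits f = [set c] ->
  slope_limits (f \o g) = [set c * l | l in slope_limits g].
Proof.
move=> qf qg c0 fc.
have [a [b [a0 gab]]] := quasi_isometry_slope_bounds g qg.
have asym e : 0 < e ->
    for_large (fun x => `|slope (f \o g) x - c * slope g x| <= e).
  move=> e0; have b0 : 0 < b.
    by have [x [_ /andP[]]] := for_large_witness _ gab; lra.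
  have [N N0 HN] := slope_limits1 _ _ qf fc (e / b) (divr_gt0 e0 b0).
  apply: for_largeW (for_largeI _ _ gab (for_large_ge (N / a))).
  move=> x x0 [/andP[ag gb]]; rewrite ler_pdivrMr// mulrC => Nx.
  have Ng : N <= (g x)%:num.
    by apply: (le_trans Nx); rewrite -ler_pdivlMr.
  have g0 : 0 < (g x)%:num by exact: lt_le_trans Ng.
  have -> : slope (f \o g) x - c * slope g x = (slope f (g x) - c) * slope g x.
    by rewrite /slope /=; field; rewrite !gt_eqF.
  have s0 : 0 <= slope g x by lra.
  rewrite normrM (ger0_norm s0).
  apply: (le_trans (ler_pM (normr_ge0 _) s0 (HN _ Ng) gb)).
  by rewrite divfK// gt_eqF.
apply/seteqP; split=> [l /slope_limitsP H|_ [l /slope_limitsP H <-]].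
- exists (l / c); last by rewrite mulrC divfK// gt_eqF.
  apply/slope_limitsP => e e0 P HP.
  have d0 : 0 < c * e / 2 by rewrite divr_gt0// mulr_gt0.
  have [x [x0 [Px ax] hl]] := H _ d0 _ (for_largeI _ _ HP (asym _ d0)).
  exists x; split=> //; rewrite -(ler_pM2l c0) -{1}(gtr0_norm c0) -normrM.
  have -> : c * (slope g x - l / c) = c * slope g x - l by field; rewrite gt_eqF.
  have := ler_distD (slope (f \o g) x) (c * slope g x) l.
  by rewrite (distrC _ (slope (f \o g) x)); lra.
- apply/slope_limitsP => e e0 P HP.
  have d0 : 0 < e / 2 by lra.
  have [x [x0 [Px ax] hl]] :=
    H _ (divr_gt0 d0 c0) _ (for_largeI _ _ HP (asym _ d0)).
  exists x; split=> //.
  have := ler_distD (c * slope g x) (slope (f \o g) x) (c * l).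
  move: hl; rewrite ler_pdivlMr// mulrC -{1}(gtr0_norm c0) -normrM mulrBr.
  lra.
Qed.

Definition dilation (c : {nonneg R}) (x : {nonneg R}) : {nonneg R} :=
  (c%:num * x%:num)%:nng.

Lemma quasi_isometry_dilation (c : {nonneg R}) :
  0 < c%:num -> quasi_isometry (dilation c).
Proof.
move=> c0; pose K := Num.max 1 (Num.max c%:num c%:num^-1).
have dE x y : `|(dilation c x)%:num - (dilation c y)%:num|
    = c%:num * `|x%:num - y%:num|.
  by rewrite /= -mulrBr normrM (gtr0_norm c0).
have cK : c%:num <= K by rewrite !le_max lexx orbT.
have VK : c%:num^-1 <= K by rewrite !le_max lexx !orbT.
apply: (@quasi_isometryP _ _ K 0) => //.
- by rewrite le_max lexx.
- move=> x y; rewrite dE addr0 mulrA ler_peMl//.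
  by rewrite -(@ler_pdivrMr _ c%:num)// mul1r.
- by move=> x y; rewrite dE addr0 ler_wpM2r.
- move=> y; have z0 : 0 <= y%:num / c%:num by rewrite divr_ge0.
  by exists (NngNum z0); rewrite /= mulrC divfK ?gt_eqF// subrr normr0.
Qed.

Lemma slope_limits_dilation (c : {nonneg R}) :
  slope_limits (dilation c) = [set c%:num].
Proof.
have sE x : 0 < x%:num -> slope (dilation c) x = c%:num.
  by move=> x0; rewrite /slope /= mulfK// gt_eqF.
apply/seteqP; split=> [l /slope_limitsP H /=|_ ->].
- apply/eqP; rewrite eq_sym -subr_eq0 -normr_eq0 eq_le normr_ge0 andbT.
  apply/ler_addgt0Pl => e e0; rewrite addr0.
  by have [x [x0 _]] := H e e0 _ (for_large_ge 0); rewrite sE.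
- apply/slope_limitsP => e e0 P /for_large_witness[x [x0 Px]].
  by exists x; rewrite sE// subrr normr0 (ltW e0).
Qed.

End Slopes.

(** * Slopes in the group of quasi-isometries *)

Section SlopeSets.
Context {R : realType}.
Implicit Types g h k : QI R.

Lemma slope_set_itv g :
  exists a b : R, [/\ 0 < a, a <= b & slope_set g = [set` `[a, b]]].
Proof.
elim/QI_ind: g => f; rewrite slope_set_pi.
by have [a [b [? ? ? _]]] := slope_limits_itv _ (qisoP f); exists a, b.
Qed.

Lemma slope_setM (c : R) h g : 0 < c -> Hc c h ->
  slope_set (h * g)%g = [set c * l | l in slope_set g].
Proof.
elim/QI_ind: h => f; elim/QI_ind: g => f' c0.
rewrite /Hc /= QI_mul_pi !slope_set_pi.
by apply: slope_limits_comp => //; exact: qisoP.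
Qed.

Lemma Hc_exists (c : R) : 0 < c -> exists h, Hc c h.
Proof.
move=> c0; pose d : {nonneg R} := NngNum (ltW c0).
exists (\pi_(QI R) (qiso_mk (@quasi_isometry_dilation _ d c0)))%qT.
by rewrite /Hc /= slope_set_pi slope_limits_dilation.
Qed.

Lemma HcM (c d : R) h k : 0 < c -> Hc c h -> Hc d k -> Hc (c * d) (h * k)%g.
Proof.
by move=> c0 hc kd; rewrite /Hc /= (slope_setM c h k c0 hc) kd image_set1.
Qed.

(** For h of slope 1, the product rule applied to h * 1 leaves the slopes of the
unit. *)
Lemma Hc1 : Hc 1 (1%g : QI R).
Proof.
have [h h1] := Hc_exists _ (@ltr01 R).
have : slope_set (h * 1)%g = [set (1:R) * l | l in slope_set (1%g : QI R)].
  exact: slope_setM.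
rewrite mulg1 h1 /Hc /=.
under eq_imagel do rewrite mul1r.
by rewrite image_id.
Qed.

(** The product rule applied to h * h^-1 = 1 forces the slopes of the inverse. *)
Lemma HcV (c : R) h : 0 < c -> Hc c h -> Hc c^-1 (h^-1)%g.
Proof.
move=> c0 hc.
have E : [set 1] = [set c * l | l in slope_set (h^-1)%g].
  by rewrite -(slope_setM c h _ c0 hc) mulgV Hc1.
have cs l : slope_set (h^-1)%g l -> l = c^-1.
  move=> sl; have : [set 1] (c * l) by rewrite E; exists l.
  by move=> /= cl; rewrite -[LHS](mulKf (lt0r_neq0 c0)) cl mulr1.
apply/seteqP; split=> [l /cs//|_ ->].
have : [set 1] (1 : R) by [].
by rewrite E => -[l sl _]; rewrite -(cs l).
Qed.

End SlopeSets.

(** * Right cosets *)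

Section Cosets.
Context {R : realType}.
Implicit Types (A : set (QI R)) (g h k : QI R).

Lemma right_coset_mull A h g :
  (forall k, A k -> A (k * h)%g) -> (forall k, A k -> A (k * h^-1)%g) ->
  right_coset A (h * g)%g = right_coset A g.
Proof.
move=> Ah AVh; apply/seteqP; split=> _ [k Ak <-].
- by exists (k * h)%g; [exact: Ah|rewrite mulgA].
- by exists (k * h^-1)%g; [exact: AVh|rewrite mulgA mulgVK].
Qed.

Lemma right_coset_Hc1 h g : Hc 1 h ->
  right_coset (Hc 1) (h * g)%g = right_coset (Hc 1) g.
Proof.
move=> h1; apply: right_coset_mull => k k1; rewrite -[1]mulr1; apply: HcM => //.
by rewrite -invr1; exact: HcV.
Qed.

Lemma right_coset_Hc_bar h g : Hc_bar R h ->
  right_coset (Hc_bar R) (h * g)%g = right_coset (Hc_bar R) g.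
Proof.
move=> [c c0 hc]; apply: right_coset_mull => k [d d0 kd].
- by exists (d * c); [exact: mulr_gt0|exact: HcM].
- exists (d * c^-1); [by rewrite /= divr_gt0|].
  by apply: HcM => //; exact: HcV.
Qed.

Lemma mem_right_coset_Hc_bar g : right_coset (Hc_bar R) g g.
Proof. by exists 1%g; rewrite ?mul1g//; exists 1; [exact: ltr01|exact: Hc1]. Qed.

End Cosets.

Theorem mainTheorem4 (R : realType) :
  exists Phi : R * set (QI R) -> set (QI R),
    (forall (M : R) (g : QI R), 1 <= M -> Hitv M g ->
       Phi (M, right_coset (Hc 1) g) = right_coset (Hc_bar R) g) /\
    set_bij (Hitv_orbits_sum R) (right_cosets (Hc_bar R)) Phi.
Proof.
(* A union over the whole orbit is independent of the chosen representative
   from the start. *)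
pose Phi (p : R * set (QI R)) := \bigcup_(k in p.2) right_coset (Hc_bar R) k.
have PhiE (M : R) (g : QI R) :
    Phi (M, right_coset (Hc 1) g) = right_coset (Hc_bar R) g.
  rewrite /Phi /=; apply/seteqP; split=> [x [_ [h h1 <-]]|x gx].
    by rewrite right_coset_Hc_bar//; exists 1 => //; exact: ltr01.
  by exists g => //; exists 1%g; [exact: Hc1|rewrite mul1g].
exists Phi; split=> [M g _ _|]; first exact: PhiE.
split.
- by move=> [M O] [/= M1 [g gM <-]]; rewrite PhiE; exists g.
(* g' = h * g with h of slope c, so comparing slope sets gives [c, c M] = [1, M'] *)
- move=> [M O] [M' O']; rewrite !inE => -[/= M1 [g gM <-]] [/= M'1 [g' gM' <-]].
  rewrite !PhiE => gg'.
  have : right_coset (Hc_bar R) g g' by rewrite gg'; exact: mem_right_coset_Hc_bar.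
  move=> [h [c c0 hc] hg]; have := slope_setM c h g c0 hc.
  rewrite hg gM gM' => E.
  have [c1 cM] : c * 1 = 1 /\ c * M = M'.
    by apply: itv_bounds_inj => //; [rewrite ler_pM2l|rewrite E image_mul_itv].
  rewrite mulr1 in c1; subst c.
  by rewrite -hg right_coset_Hc1// -cM mul1r.
(* rescaling [a, b] by a^-1 normalises the left end to 1 *)
- move=> _ [g _ <-]; have [a [b [a0 ab gab]]] := slope_set_itv g.
  have [h ha] : exists h : QI R, Hc a^-1 h by apply: Hc_exists; rewrite invr_gt0.
  have a'0 : 0 < a^-1 by rewrite invr_gt0.
  exists (b / a, right_coset (Hc 1) (h * g)%g); last first.
    by rewrite PhiE right_coset_Hc_bar//; exists a^-1.
  split=> /=; first by rewrite ler_pdivlMr// mul1r.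
  exists (h * g)%g => //.
  rewrite /Hitv /= (slope_setM a^-1 h g a'0 ha) gab image_mul_itv//.
  by rewrite mulVf ?gt_eqF// mulrC.
Qed.
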